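(* There exists an oracle $A$ relative to which $\mathsf{BPP}_{||}^{\mathsf{NP}}$ has linear-size circuits: for every language $L\in\mathsf{BPP}_{||}^{\mathsf{NP}^{A}}$ there is a constant $c$ and a family of circuits $(C_n)$ with oracle gates for $A$, $C_n$ of size at most $cn$, such that $C_n$ decides $L\cap\{0,1\}^n$ for every $n$.
   Context: $\mathsf{BPP}_{||}^{\mathsf{NP}}$ is the class of languages decidable by a probabilistic polynomial-time machine with bounded error (error at most $1/3$ on every input) that makes only nonadaptive (parallel) queries to an $\mathsf{NP}$ oracle, i.e. all queries are computed before any answers are received. Relative to $A$, the $\mathsf{NP}$ oracle is replaced by an $\mathsf{NP}^{A}$ oracle. A circuit relative to $A$ is a Boolean circuit that may contain gates computing the characteristic function of $A$. *)

(* Defs.v *)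
From HB Require Import structures.
From mathcomp Require Import all_boot all_algebra.

Set Implicit Arguments.
Unset Strict Implicit.
Unset Printing Implicit Defensive.

Definition language := pred (seq bool).

(* Value of a polynomial with natural coefficients. *)
Definition polyval (p : {poly nat}) (n : nat) : nat := horner p n.

(** * Deterministic multitape oracle Turing machines *)

Inductive symbol := Blank | Sep | Bit of bool.

Inductive direction := Left | Stay | Right.

(* [Query qy qn] asks the oracle for the word currently on the query tape and
   goes to state [qy] or [qn] according to the answer; [Halt b] accepts iff
   [b = true]. *)
Inductive instruction (s k : nat) :=
  | Halt of bool
  | Query of 'I_s & 'I_s
  | Move of 'I_s & k.-tuple (symbol * direction).

Arguments Halt {s k}.
Arguments Query {s k}.
Arguments Move {s k}.

(* Tape [ord0] is the input tape; tape [ord_max] is the query tape, which also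
   carries the output when the machine halts; there are [nwork] further work
   tapes. The initial state is [ord0]. *)
Record machine := Machine {
  nstates : nat;
  nwork : nat;
  delta : 'I_nstates.+1 -> nwork.+2.-tuple symbol ->
          instruction nstates.+1 nwork.+2
}.

(* A one-way infinite tape: its cells from the left end (all the cells beyond
   the sequence are blank) and the position of the head. *)
Definition tape := (seq symbol * nat)%type.

Definition read_tape (t : tape) : symbol := nth Blank t.1 t.2.

(* Moving left from the leftmost cell leaves the head in place. *)
Definition update_tape (t : tape) (a : symbol * direction) : tape :=
  (set_nth Blank t.1 t.2 a.1,
   match a.2 with Left => t.2.-1 | Stay => t.2 | Right => t.2.+1 end).

(* The word on the query tape: the bits from the left end of the tape up to
   the first cell that does not contain a bit. *)
Fixpoint query_word (s : seq symbol) : seq bool :=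
  if s is Bit b :: s' then b :: query_word s' else [::].

(* [run O M t q ts] is [None] when [M] does not halt within [t] steps from
   state [q] and tapes [ts], and otherwise its verdict and its output tape. *)
Fixpoint run (O : language) (M : machine) (t : nat)
    (q : 'I_(nstates M).+1) (ts : (nwork M).+2.-tuple tape) {struct t} :
    option (bool * seq symbol) :=
  if t is t'.+1 then
    match delta q [tuple read_tape (tnth ts i) | i < (nwork M).+2] with
    | Halt b => Some (b, (tnth ts ord_max).1)
    | Query qy qn =>
        run O t' (if O (query_word (tnth ts ord_max).1) then qy else qn) ts
    | Move q' acts =>
        run O t' q'
          [tuple update_tape (tnth ts i) (tnth acts i) | i < (nwork M).+2]
    end
  else None.

Definition init_tapes (k : nat) (z : seq symbol) : k.+2.-tuple tape :=
  [tuple (if i == ord0 then z else [::], 0) | i < k.+2].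

Definition exec (O : language) (M : machine) (t : nat) (z : seq symbol) :=
  @run O M t ord0 (init_tapes (nwork M) z).

(* Whether [M] halts on every input [z] within [p(|z|)] steps. *)
Definition runs_in_time (O : language) (M : machine) (p : {poly nat}) : Prop :=
  forall z : seq symbol, exec O M (polyval p (size z)) z <> None.

(* The verdict and the output of a machine running in time [p]. *)
Definition accepts (O : language) (M : machine) (p : {poly nat})
    (z : seq symbol) : bool :=
  if exec O M (polyval p (size z)) z is Some (b, _) then b else false.

Definition output (O : language) (M : machine) (p : {poly nat})
    (z : seq symbol) : seq symbol :=
  if exec O M (polyval p (size z)) z is Some (_, o) then o else [::].

(* A list of words is written on a tape with [Sep] after each word. *)
Definition encode (ws : seq (seq bool)) : seq symbol :=
  flatten [seq rcons [seq Bit b | b <- w] Sep | w <- ws].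

(* Inverse of [encode]: reads the words terminated by [Sep] up to the first
   blank; [w] accumulates the current word. *)
Fixpoint decode_from (w : seq bool) (s : seq symbol) : seq (seq bool) :=
  match s with
  | Bit b :: s' => decode_from (rcons w b) s'
  | Sep :: s' => w :: decode_from [::] s'
  | _ => [::]
  end.

Definition decode : seq symbol -> seq (seq bool) := decode_from [::].

(** * Complexity classes *)

Definition in_NP (A : language) (K : language) : Prop :=
  exists (V : machine) (p q : {poly nat}),
    runs_in_time A V p /\
    forall x : seq bool,
      K x <->
      exists2 w : seq bool, size w <= polyval q (size x) &
        accepts A V p (encode [:: x; w]).

(* The oracle available to a machine that has none. *)
Definition no_oracle : language := pred0.

(* One computation of a nonadaptive machine with oracle [K] on input [x] and
   coin tosses [r]: [G] computes the list of all queries from [x] and [r]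
   alone, then [D] decides from [x], [r] and the list of answers. *)
Definition nonadaptive_accepts (K : language) (G : machine) (pG : {poly nat})
    (D : machine) (pD : {poly nat}) (x r : seq bool) : bool :=
  let queries := decode (output no_oracle G pG (encode [:: x; r])) in
  accepts no_oracle D pD (encode [:: x; r; [seq K u | u <- queries]]).

(* BPP with nonadaptive queries to an NP oracle, relative to [A]: on every
   input at most a third of the coin sequences lead to a wrong verdict. *)
Definition in_BPP_par_NP (A : language) (L : language) : Prop :=
  exists K : language, in_NP A K /\
  exists (G D : machine) (pG pD m : {poly nat}),
    [/\ runs_in_time no_oracle G pG,
        runs_in_time no_oracle D pD &
        forall x : seq bool,
          let l := polyval m (size x) in
          3 * #|[set r : l.-tuple bool |
                   nonadaptive_accepts K G pG D pD x r != L x]| <= 2 ^ l].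

(** * Circuits with oracle gates *)

(* The sources from which a gate can be fed: an input bit, a constant, or the
   value of the gate of given rank. *)
Inductive wire (n : nat) :=
  | Input of 'I_n
  | Const of bool
  | FromGate of nat.

Arguments Const {n}.
Arguments FromGate {n}.

Inductive gate (n : nat) :=
  | And of wire n & wire n
  | Or of wire n & wire n
  | Not of wire n
  | OracleGate of seq (wire n).

Definition fanin (n : nat) (g : gate n) : seq (wire n) :=
  match g with
  | And u v | Or u v => [:: u; v]
  | Not u => [:: u]
  | OracleGate us => us
  end.

Definition wire_before (n i : nat) (u : wire n) : bool :=
  if u is FromGate j then j < i else true.

(* Acyclicity: a gate is fed only by gates of smaller rank; [i] is the rank of
   the first gate of the list. *)
Fixpoint gates_wf (n i : nat) (gs : seq (gate n)) : bool :=
  if gs is g :: gs' then all (wire_before i) (fanin g) && gates_wf i.+1 gs'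
  else true.

Record circuit (n : nat) := Circuit {
  gates : seq (gate n);
  outw : wire n;
  circuit_wf : gates_wf 0 gates && wire_before (size gates) outw
}.

Definition wire_val (n : nat) (x : n.-tuple bool) (vals : seq bool)
    (u : wire n) : bool :=
  match u with
  | Input i => tnth x i
  | Const b => b
  | FromGate j => nth false vals j
  end.

Definition gate_val (A : language) (n : nat) (x : n.-tuple bool)
    (vals : seq bool) (g : gate n) : bool :=
  let v := wire_val x vals in
  match g with
  | And u1 u2 => v u1 && v u2
  | Or u1 u2 => v u1 || v u2
  | Not u => ~~ v u
  | OracleGate us => A [seq v u | u <- us]
  end.

Definition circuit_eval (A : language) (n : nat) (C : circuit n)
    (x : n.-tuple bool) : bool :=
  let vals :=
    foldl (fun vals g => rcons vals (gate_val A x vals g)) [::] (gates C) in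
  wire_val x vals (outw C).

(* The number of gates plus the number of wires entering them, so that an
   oracle gate is charged for the length of its query. Input bits and constants
   are leaves and are free; hence a size bound of [c * n] makes sense for
   [n = 0]. *)
Definition circuit_size (n : nat) (C : circuit n) : nat :=
  \sum_(g <- gates C) (size (fanin g)).+1.

Definition has_linear_size_circuits (A : language) (L : language) : Prop :=
  exists (c : nat) (C : forall n : nat, circuit n),
    forall n : nat,
      circuit_size (C n) <= c * n /\
      forall x : n.-tuple bool, circuit_eval A (C n) x = L x.

(* Main.v *)
(** The circuit for [L] on inputs of length [n] is a single oracle gate: it asks
    for the word [(e, n, x, z)], where [e] is an index of the machine deciding
    [L], [x] is the input and [z] is an advice string of length linear in [n].
    So [A] must have, for all [e] and [n], an advice [z] such that the row
    [x |-> A (e, n, x, z)] is the language of machine [e] relative to [A]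
    itself.

    Consider the weighted sum, over all [e], [n], [x] and all coin sequences, of
    the number of NP queries answered yes plus one if the verdict agrees with
    the row currently selected for [(e, n)]. An oracle and a selection
    maximizing it are as required. Suppose that on some [x] at most a third of
    the coins agree with the row of [(e, n)]; select another advice [z] and
    overwrite its row with the majority verdicts. This gains a third of a unit
    at [x]. A computation whose answers change either has a query turned from
    no to yes, which makes up for any change of its verdict, or has one turned
    from yes to no; but the latter needs the row of [z] to meet an accepting
    path of that query, and as paths are short, this is negligible on average
    over [z].

    Maximizers exist for the finitely many [e, n < N], and a limit point of them
    as [N] grows is good for all [e] and [n], because the requirement at
    [(e, n)] involves only finitely many bits of the oracle. *)

From HB Require Import structures.
Require Import Defs.
From mathcomp Require Import all_boot all_algebra.
From mathcomp Require Import boolp zify.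

Set Implicit Arguments.
Unset Strict Implicit.
Unset Printing Implicit Defensive.

(** * Sums, maxima and counting *)

Lemma leq_sum_gap (I : finType) (F G : I -> nat) (i0 : I) (g : nat) :
  (forall i, F i <= G i) -> F i0 + g <= G i0 ->
  \sum_i F i + g <= \sum_i G i.
Proof.
move=> leFG ltFG; rewrite (bigD1 i0) // [leqRHS](bigD1 i0) //= addnAC.
by apply: leq_add => //; apply: leq_sum.
Qed.

Lemma ex_small_summand (I : finType) (F : I -> nat) (D : nat) :
  0 < #|I| -> \sum_i F i <= D -> exists i, #|I| * F i <= D.
Proof.
move=> /card_gt0P[i0 _] leFD; have [i _ minF] := arg_minnP F (erefl (xpredT i0)).
exists i; apply: leq_trans leFD; rewrite -sum_nat_const.
by apply: leq_sum => j _; apply: minF.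
Qed.

Lemma ex_maximizer (T : Type) (f : T -> nat) (x0 : T) (b : nat) :
  (forall x, f x <= b) -> exists x, forall y, f y <= f x.
Proof.
move=> fb; have bP : forall n, `[< exists x, f x = n >] -> n <= b.
  by move=> n /asboolP[x <-].
have ex0 : exists n, `[< exists x, f x = n >].
  by exists (f x0); apply/asboolP; exists x0.
have [n /asboolP[x <-] max] := ex_maxnP ex0 bP.
by exists x => y; apply: max; apply/asboolP; exists y.
Qed.

Lemma sum_expn2B (H N : nat) :
  N <= H -> \sum_(n < N) 2 ^ (H - n) <= 2 ^ H.+1.
Proof.
move=> leNH; suff: \sum_(n < N) 2 ^ (H - n) + 2 ^ (H - N).+1 <= 2 ^ H.+1 by lia.
elim: N leNH => [|N IH] leNH; first by rewrite big_ord0 subn0.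
rewrite big_ord_recr /= -addnA; apply: leq_trans (IH (ltnW leNH)).
by rewrite leq_add2l -subSn // subSS expnS; lia.
Qed.

(** [h] pays for every element lost from [a] to [b]. If the lists differ, either an element is
    gained, or one is lost and [h] has a positive sum; doubling that sum makes the inequality strict
    in both cases. *)
Lemma count_gain (U : Type) (a b : pred U) (h : U -> nat) (s : seq U) :
  (forall u, a u <= b u + h u) ->
  [seq a u | u <- s] = [seq b u | u <- s] \/
  count a s < count b s + 2 * \sum_(u <- s) h u.
Proof.
move=> leab.
have le_count t : count a t <= count b t + \sum_(u <- t) h u.
  elim: t => [|u t IH]; rewrite ?big_nil // big_cons /=.
  by have := leab u; lia.
elim: s => [|u s IH]; [by left | rewrite big_cons /=].
have := leab u; have := le_count s.
case: IH => [->|]; last by right; lia.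
have [->|] := eqVneq (a u) (b u); first by left.
by case: (a u) (b u) => -[] // _; right; lia.
Qed.

(** * Compactness of the space of oracles *)

(* Only infinitely repeated prefixes are extended, so that every finite part of
   the limit is shared by infinitely many of the sequences. *)
Lemma cantor_limit (a : nat -> nat -> bool) :
  exists b : nat -> bool, forall k N, exists2 N', N <= N' &
    forall i, i < k -> a N' i = b i.
Proof.
pose recur s := forall N, exists2 N', N <= N' &
  forall i, i < size s -> a N' i = nth false s i.
pose ext s := rcons s `[< recur (rcons s true) >].
pose s k := iter k ext [::].
have size_s k : size (s k) = k.
  by elim: k => //= k IH; rewrite size_rcons -/(s k) IH.
have s_recur k : recur (s k).
  elim: k => [|k IH] N; first by exists N.
  rewrite /s iterS -/(s k) /ext; case: asboolP => [|not_true]; first exact.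
  (* From some stage on no sequence extends [s k] by true, so the later ones that share [s k]
     continue with false. *)
  have [N0 N0P] : exists N0, forall N', N0 <= N' ->
      ~ forall i, i < k.+1 -> a N' i = nth false (rcons (s k) true) i.
    apply: contra_notP not_true => no_N0 M; apply: contrapT => noN'.
    apply: no_N0; exists M => N' leMN' aP; apply: noN'; exists N' => //.
    by rewrite size_rcons size_s.
  have [N' leN' aP] := IH (maxn N N0); exists N'; first by lia.
  rewrite size_rcons size_s => i; rewrite ltnS leq_eqVlt => /predU1P[->|ltik].
    rewrite nth_rcons size_s ltnn eqxx; apply/negbTE/negP => aT.
    apply: (N0P N') => [|j]; first by lia.
    rewrite nth_rcons size_s ltnS; case: ltngtP => // [ltjk _|-> _ //].
    by apply: aP; rewrite size_s.
  by rewrite nth_rcons size_s ltik; apply: aP; rewrite size_s.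
have nth_s i k : i < k -> nth false (s k) i = nth false (s i.+1) i.
  elim: k => // k IH; rewrite ltnS leq_eqVlt => /predU1P[->//|ltik].
  by rewrite /s iterS -/(s k) nth_rcons size_s ltik IH.
exists (fun i => nth false (s i.+1) i) => k N.
have [N' leN' aP] := s_recur k N; exists N' => // i ltik.
by rewrite aP ?size_s // nth_s.
Qed.

Lemma language_limit (a : nat -> language) :
  exists A : language, forall (S : seq (seq bool)) (N : nat),
    exists2 N', N <= N' & {in S, a N' =1 A}.
Proof.
have [b bP] := cantor_limit (fun N i => oapp (a N) false (unpickle i)).
exists (fun w => b (pickle w)) => S N.
have [N' leN' aP] := bP (\max_(w <- S) pickle w).+1 N; exists N' => // w Sw.
by rewrite -aP ?pickleK // ltnS; apply: (@leq_bigmax_seq _ _ xpredT).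
Qed.

(** * Words consulted by the circuits *)

(** The unary numbers are self-delimiting and [n] tells where [x] ends, so distinct quadruples with
    [size x = n] get distinct words. For fixed [e] the length is linear in [n] if that of [z] is. *)
Definition advice_word (e n : nat) (x z : seq bool) : seq bool :=
  nseq e true ++ false :: nseq n true ++ false :: x ++ z.

Lemma nseq_true_inj (m n : nat) (s t : seq bool) :
  nseq m true ++ false :: s = nseq n true ++ false :: t -> m = n /\ s = t.
Proof.
by elim: m n => [|m IH] [|n] //= [] // /IH[-> ->].
Qed.

Lemma advice_word_inj (e e' n n' : nat) (x x' z z' : seq bool) :
  size x = n -> size x' = n' ->
  advice_word e n x z = advice_word e' n' x' z' ->
  [/\ e = e', n = n', x = x' & z = z'].
Proof.
move=> sx sx' /nseq_true_inj[-> /nseq_true_inj[eqn]].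
by move/eqP; rewrite eqseq_cat ?sx ?sx' // => /andP[/eqP-> /eqP->].
Qed.

Lemma size_advice_word (e n : nat) (x z : seq bool) :
  size (advice_word e n x z) = e + n + size x + size z + 2.
Proof.
by rewrite !(size_cat, size_nseq) /= !(size_cat, size_nseq) /= size_cat; lia.
Qed.

(** * Testers with certified answers *)

(** A nonadaptive machine in the abstract: [queries] does not see the oracle, which acts on the
    verdict only through [answer]. *)
Record tester := Tester {
  coins : nat -> nat;
  queries : seq bool -> seq bool -> seq (seq bool);
  answer : language -> pred (seq bool);
  verdict : seq bool -> seq bool -> seq bool -> bool
}.

Definition tester_val (A : language) (T : tester) (x r : seq bool) : bool :=
  verdict T x r [seq answer T A u | u <- queries T x r].

Definition certifies (T : tester) (u : seq bool) (A : language)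
    (S : seq (seq bool)) : Prop :=
  forall A' : language, {in S, A =1 A'} -> answer T A' u.

(** One-sided as in NP: a yes is certified by few words, while nothing is asked of a no. *)
Definition certificate_bound (T : tester) (cost : seq bool -> nat) : Prop :=
  forall A u, answer T A u ->
    exists2 S, size S <= cost u & certifies T u A S.

Definition total_cost_bound (T : tester) (cost : seq bool -> nat) (d : nat) :
    Prop :=
  forall n x r, size x = n -> size r = coins T n ->
    \sum_(u <- queries T x r) cost u <= 2 ^ (n + d).

Definition finitely_determined (T : tester) : Prop :=
  forall u, exists S : seq (seq bool), forall A A' : language,
    {in S, A =1 A'} -> answer T A u = answer T A' u.

Definition advised (T : nat -> tester) (A : language) (e n : nat)
    (z : seq bool) : Prop :=
  forall x : n.-tuple bool,
    2 ^ coins (T e) n < 3 * #|[set r : (coins (T e) n).-tuple bool |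
      tester_val A (T e) x r == A (advice_word e n x z)]|.

(** * The potential and its maximizers *)

Section Potential.

Variables (T : nat -> tester) (d : nat -> nat) (N : nat).

(** [d e] absorbs the cost bound, [e] makes the weights summable, and the 1 makes [k e] positive,
    which yields the factor [2 ^ 6] in the comparison of gain and loss. *)
Let k e := e + d e + 1.

Definition advice_size (e n : nat) : nat := 8 * (n + k e).

(* Scaling by [2 ^ H] makes the weights [2 ^ - (coins + 4 n + 2 k)] integral. *)
Let H := 2 * N + \sum_(e < N) \sum_(n < N) (coins (T e) n + 4 * n + 2 * k e).

Let weight e n := 2 ^ (H - (coins (T e) n + 4 * n + 2 * k e)).

Lemma weight_exponent (e n : 'I_N) :
  2 * N + (coins (T e) n + 4 * n + 2 * k e) <= H.
Proof.
rewrite leq_add2l (bigD1 e) //=; apply: leq_trans (leq_addr _ _).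
by rewrite (bigD1 n) //= leq_addr.
Qed.

Definition total (F : nat -> nat -> seq bool -> seq bool -> nat) : nat :=
  \sum_(e < N) \sum_(n < N) \sum_(x : n.-tuple bool)
    \sum_(r : (coins (T e) n).-tuple bool) weight e n * F e n x r.

Lemma leq_total F G :
  (forall e n x r, size x = n -> size r = coins (T e) n ->
    F e n x r <= G e n x r) ->
  total F <= total G.
Proof.
move=> leFG; do 4![apply: leq_sum => ? _].
by rewrite leq_mul2l leFG ?size_tuple ?orbT.
Qed.

Lemma totalD F G :
  total (fun e n x r => F e n x r + G e n x r) = total F + total G.
Proof.
rewrite /total -big_split; apply: eq_bigr => e _ /=.
rewrite -big_split; apply: eq_bigr => n _ /=.
rewrite -big_split; apply: eq_bigr => x _ /=.
by rewrite -big_split; apply: eq_bigr => r _ /=; rewrite mulnDr.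
Qed.

Lemma total_sum (I : finType)
    (F : I -> nat -> nat -> seq bool -> seq bool -> nat) :
  \sum_i total (F i) = total (fun e n x r => \sum_i F i e n x r).
Proof.
rewrite /total exchange_big; apply: eq_bigr => e _ /=.
rewrite exchange_big; apply: eq_bigr => n _ /=.
rewrite exchange_big; apply: eq_bigr => x _ /=.
by rewrite exchange_big; apply: eq_bigr => r _ /=; rewrite big_distrr.
Qed.

(** The weight cancels the number of coin sequences, the [2 ^ n] inputs and the bound on [F]; the
    rest is at most [2 ^ ((H - e).-1 - n)], a geometric series in [n] and then in [e]. *)
Lemma total_bound F :
  (forall e n x r, size x = n -> size r = coins (T e) n ->
    F e n x r <= 2 ^ (n + d e)) ->
  total F <= 2 ^ H.+1.
Proof.
move=> leF; apply: (@leq_trans (\sum_(e < N) 2 ^ (H - e))); last first.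
  by apply: sum_expn2B; rewrite /H; lia.
apply: leq_sum => e _.
apply: (@leq_trans (\sum_(n < N) 2 ^ ((H - e).-1 - n))); last first.
  have [ltNe n0] : e < N /\ 2 * N <= H by split; [|rewrite /H; lia].
  apply: leq_trans (sum_expn2B _) _; first by lia.
  by rewrite leq_exp2l //; lia.
apply: leq_sum => n _; have := weight_exponent e n => leH.
apply: (@leq_trans (\sum_(x : n.-tuple bool)
    \sum_(r : (coins (T e) n).-tuple bool) weight e n * 2 ^ (n + d e))).
  do 2![apply: leq_sum => ? _].
  by rewrite leq_mul2l leF ?size_tuple ?orbT.
rewrite !sum_nat_const !card_tuple card_bool /weight -!expnD leq_exp2l //.
by have := ltn_ord e; have := ltn_ord n; rewrite /k in leH *; lia.
Qed.

(** The row bit [b] is a separate argument so that the row and the oracle behind the answers can be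
    changed one after the other. *)
Definition score (A : language) (e : nat) (x r : seq bool) (b : bool) : nat :=
  count (answer (T e) A) (queries (T e) x r) + (tester_val A (T e) x r == b).

Definition potential (A : language) (zeta : nat -> nat -> seq bool) : nat :=
  total (fun e n x r => score A e x r (A (advice_word e n x (zeta e n)))).

(* A change of the verdict costs at most 1, and is paid for by an answer turned
   from no to yes, or by a second unit for one turned from yes to no. *)
Lemma score_change (A A' : language) (e : nat) (x r : seq bool) (b : bool)
    (h : seq bool -> nat) :
  (forall u, answer (T e) A u <= answer (T e) A' u + h u) ->
  score A e x r b <=
  score A' e x r b + 2 * \sum_(u <- queries (T e) x r) h u.
Proof.
move=> leA; rewrite /score /tester_val.
have [eqA|] := count_gain (queries (T e) x r) leA; last first.
  by do 2![case: (_ == _)]; lia.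
have -> : count (answer (T e) A) (queries (T e) x r) =
          count (answer (T e) A') (queries (T e) x r).
  by have := congr1 (count id) eqA; rewrite !count_map.
by rewrite eqA; lia.
Qed.

(** * Overwriting the row of one advice *)

Section Overwrite.

Variables (A : language) (zeta : nat -> nat -> seq bool) (e0 n0 : nat).

Let agreements (x : seq bool) (b : bool) :=
  \sum_(r : (coins (T e0) n0).-tuple bool) (tester_val A (T e0) x r == b).

Definition majority (x : seq bool) : bool :=
  agreements x false <= agreements x true.

Lemma agreements_total x b :
  agreements x b + agreements x (~~ b) = 2 ^ coins (T e0) n0.
Proof.
rewrite -big_split /= (eq_bigr (fun=> 1)) => [|r _]; last first.
  by case: tester_val b => -[].
by rewrite sum1_card card_tuple card_bool.
Qed.

Lemma leq_majority x b : agreements x b <= agreements x (majority x).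
Proof.
by rewrite /majority; case: (leqP (agreements x false)) => [|/ltnW]; case: b.
Qed.

(** The majority refers to the old oracle [A]; the effect of the new one on the testers is bounded
    in [overwrite_loss]. *)
Definition overwrite (z : seq bool) : language := fun w =>
  if [pick x : n0.-tuple bool | w == advice_word e0 n0 x z] is Some x
  then majority x else A w.

Definition redirect (z : seq bool) (e n : nat) : seq bool :=
  if (e == e0) && (n == n0) then z else zeta e n.

Definition hits (z w : seq bool) : bool :=
  [exists x : n0.-tuple bool, w == advice_word e0 n0 x z].

Lemma overwrite_out z w : ~~ hits z w -> overwrite z w = A w.
Proof.
rewrite /overwrite; case: pickP => // x hx /negP[].
by apply/existsP; exists x.
Qed.

Lemma overwrite_in z (x : n0.-tuple bool) :
  overwrite z (advice_word e0 n0 x z) = majority x.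
Proof.
rewrite /overwrite; case: pickP => [y|/(_ x)]; last by rewrite eqxx.
by move=> /eqP/advice_word_inj; rewrite !size_tuple => -[] // _ _ ->.
Qed.

(** A word determines its advice, so rows of different advices are disjoint. This keeps the damage
    small on average over [z]. *)
Lemma sum_hits w : \sum_(z : (advice_size e0 n0).-tuple bool) hits z w <= 1.
Proof.
have [[z /= hz]|no_hit] :=
  pselect (exists z : (advice_size e0 n0).-tuple bool, hits z w).
  rewrite (bigD1 z) //= big1 ?addn0 ?leq_b1 // => z' /eqP neq.
  apply/eqP; rewrite eqb0; apply/negP => hz'; apply: neq; apply: val_inj.
  have [x /eqP def_w] := existsP hz; have [x' /eqP] := existsP hz'.
  by rewrite def_w => /advice_word_inj; rewrite !size_tuple => -[].
rewrite big1 // => z _; apply/eqP; rewrite eqb0; apply/negP => hz.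
by case: no_hit; exists z.
Qed.

Lemma overwrite_other z e n (x : n.-tuple bool) :
  (e == e0) && (n == n0) = false ->
  overwrite z (advice_word e n x (redirect z e n)) =
  A (advice_word e n x (zeta e n)).
Proof.
move=> neq; rewrite /redirect neq overwrite_out //; apply/existsP => -[y /eqP].
move=> /advice_word_inj; rewrite !size_tuple => -[] // ee en _ _.
by rewrite ee en !eqxx in neq.
Qed.

Hypotheses (lt_e0 : e0 < N) (lt_n0 : n0 < N).

Lemma sum_score e n (x : seq bool) b :
  \sum_(r : (coins (T e) n).-tuple bool) weight e n * score A e x r b =
  weight e n * (\sum_(r : (coins (T e) n).-tuple bool)
                   count (answer (T e) A) (queries (T e) x r) +
                \sum_(r : (coins (T e) n).-tuple bool)
                   (tester_val A (T e) x r == b)).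
Proof. by rewrite -big_distrr -big_split. Qed.

Lemma overwrite_row z e n (x : n.-tuple bool) :
  \sum_(r : (coins (T e) n).-tuple bool)
    weight e n * score A e x r (A (advice_word e n x (zeta e n))) <=
  \sum_(r : (coins (T e) n).-tuple bool)
    weight e n * score A e x r (overwrite z (advice_word e n x (redirect z e n))).
Proof.
have [/andP[/eqP ee /eqP en]|neq] := boolP ((e == e0) && (n == n0)); last first.
  by rewrite (overwrite_other _ _ (negbTE neq)).
subst e n; rewrite /redirect !eqxx overwrite_in !sum_score leq_mul2l leq_add2l.
by rewrite leq_majority orbT.
Qed.

(** Only the row bits change here; the testers still consult [A]. No row loses, and at [x0] the
    majority has at least two thirds of the coins against at most one third for the old bit. *)
Lemma overwrite_gain (z : seq bool) (x0 : n0.-tuple bool) :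
  3 * agreements x0 (A (advice_word e0 n0 x0 (zeta e0 n0))) <=
    2 ^ coins (T e0) n0 ->
  exists2 gain, 2 ^ (H - (4 * n0 + 2 * k e0)) <= 3 * gain &
  potential A zeta + gain <= total (fun e n x r =>
    score A e x r (overwrite z (advice_word e n x (redirect z e n)))).
Proof.
set b := A _ => few.
pose diff := agreements x0 (majority x0) - agreements x0 b.
exists (weight e0 n0 * diff).
  have leH := weight_exponent (Ordinal lt_e0) (Ordinal lt_n0).
  rewrite /= in leH.
  rewrite mulnCA; apply: (@leq_trans (weight e0 n0 * 2 ^ coins (T e0) n0)).
    by rewrite /weight -expnD leq_exp2l //; lia.
  rewrite leq_mul2l; apply/orP; right; rewrite /diff.
  have := leq_majority x0 (~~ b); have := agreements_total x0 b.
  by have := leq_majority x0 b; lia.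
apply: (leq_sum_gap (i0 := Ordinal lt_e0)) => [e|].
  by do 2![apply: leq_sum => ? _]; apply: overwrite_row.
apply: (leq_sum_gap (i0 := Ordinal lt_n0)) => [n|].
  by apply: leq_sum => ? _; apply: overwrite_row.
apply: (leq_sum_gap (i0 := x0)) => [x|]; first exact: overwrite_row.
rewrite !sum_score /= /redirect !eqxx overwrite_in -mulnDr leq_mul2l.
rewrite -addnA leq_add2l -/(agreements x0 b) -/(agreements x0 (majority x0)).
by rewrite subnKC ?leq_majority ?orbT.
Qed.

Variable cost : nat -> seq bool -> nat.
Hypothesis certP : forall e, certificate_bound (T e) (cost e).
Hypothesis costP : forall e, total_cost_bound (T e) (cost e) (d e).

(** Now the testers pass from [A] to the overwritten oracle. An answer turns from yes to no only if
    its certificate is hit; each certificate word is hit for at most one [z], so some [z] does at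
    most average damage. *)
Lemma overwrite_loss :
  exists2 loss, 2 ^ (8 * (n0 + k e0)) * loss <= 2 ^ H.+1 &
  exists z : (advice_size e0 n0).-tuple bool,
    total (fun e n x r =>
      score A e x r (overwrite z (advice_word e n x (redirect z e n)))) <=
    potential (overwrite z) (redirect z) + 2 * loss.
Proof.
(* Certificates are fixed for [A] before [z] is chosen. *)
pose good (eu : nat * seq bool) S := size S <= cost eu.1 eu.2 /\
  (answer (T eu.1) A eu.2 -> certifies (T eu.1) eu.2 A S).
have [|S SP] := choice (P := good).
  case=> e u; case: (boolP (answer (T e) A u)) => [yes|no].
    by have [S] := certP yes; exists S.
  by exists [::]; split=> // yes; case/negP: no.
pose lost z e u := \sum_(w <- S (e, u)) hits z w.
pose loss z := total (fun e _ x r => \sum_(u <- queries (T e) x r) lost z e u).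
have : \sum_(z : (advice_size e0 n0).-tuple bool) loss z <= 2 ^ H.+1.
  rewrite /loss total_sum; apply: total_bound => e n x r sx sr.
  apply: leq_trans (costP sx sr); rewrite exchange_big; apply: leq_sum => u _.
  rewrite /lost exchange_big /=; apply: leq_trans (SP (e, u)).1.
  by rewrite -sum1_size; apply: leq_sum => w _; apply: sum_hits.
move/ex_small_summand; rewrite card_tuple card_bool expn_gt0 => -[] // z leD.
exists (loss z) => //; exists z; rewrite /loss.
rewrite mul2n -addnn -!totalD; apply: leq_total => e n x r _ _.
rewrite addnn -mul2n; apply: score_change => u.
case: (boolP (answer (T e) A u)) => // yes.
have [|/hasPn no_hit] := boolP (has (hits z) (S (e, u))).
  move=> /hasP[w Sw hw]; rewrite /lost (perm_big _ (perm_to_rem Sw)) big_cons hw.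
  by rewrite addnCA leq_addr.
rewrite (_ : answer _ _ _ = true) //; apply: (SP (e, u)).2 => //= w Sw.
by rewrite overwrite_out // no_hit.
Qed.

End Overwrite.

(** The queries, hence their number, do not depend on the oracle. *)
Lemma potential_bounded :
  exists b, forall A zeta, potential A zeta <= b.
Proof.
exists (total (fun e _ x r => size (queries (T e) x r) + 1)) => A zeta.
apply: leq_total => e n x r _ _; apply: leq_add (leq_b1 _); exact: count_size.
Qed.

Lemma advised_below (cost : nat -> seq bool -> nat) :
  (forall e, certificate_bound (T e) (cost e)) ->
  (forall e, total_cost_bound (T e) (cost e) (d e)) ->
  exists A, forall e n, e < N -> n < N ->
    exists2 z, size z = advice_size e n & advised T A e n z.
Proof.
move=> certP costP.
pose state := (language * {zeta : nat -> nat -> seq bool |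
  forall e n, size (zeta e n) = advice_size e n})%type.
have zeta0P e n : size (nseq (advice_size e n) false) = advice_size e n.
  exact: size_nseq.
pose state0 : state := (xpred0, exist _ _ zeta0P).
have [b bP] := potential_bounded.
have [[A [zeta zetaP]] /= max] :=
  ex_maximizer state0 (fun s : state => bP s.1 (sval s.2)).
exists A => e n lt_e lt_n; exists (zeta e n) => // x; rewrite ltnNge; apply/negP.
rewrite -sum1dep_card big_mkcond /= => few.
have [loss lossP [z zP]] := overwrite_loss A zeta e n certP costP.
have redirectP e' n' : size (redirect zeta e n z e' n') = advice_size e' n'.
  by rewrite /redirect; case: andP => [[/eqP-> /eqP->]|]; rewrite ?size_tuple.
have := max (overwrite A e n z, exist _ _ redirectP) => /= le_max.
have [|gain gainP le_gain] :=
  overwrite_gain (A := A) (zeta := zeta) lt_e lt_n z (x0 := x).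
  apply: leq_trans few; rewrite leq_mul2l; apply/orP; right.
  by apply: leq_sum => r _; case: eqP.
(* By maximality the new potential does not exceed the old one. *)
have {le_gain zP} le_gain : gain <= 2 * loss by lia.
have leH := weight_exponent (Ordinal lt_e) (Ordinal lt_n); rewrite /= in leH.
(* Multiplied by [2 ^ (8 * (n + k e))], three gains are at least [64 * 2 ^ H], since [k e] is
   positive, but six losses at most [12 * 2 ^ H]. *)
have : 2 ^ (8 * (n + k e)) * 2 ^ (H - (4 * n + 2 * k e)) >= 2 ^ 6 * 2 ^ H.
  by rewrite -!expnD leq_exp2l // /k; rewrite /k in leH; lia.
rewrite leqNgt => /negP[].
apply: (@leq_ltn_trans (6 * (2 ^ (8 * (n + k e)) * loss))).
  by rewrite mulnCA leq_mul2l; apply/orP; right; lia.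
apply: (@leq_ltn_trans (6 * 2 ^ H.+1)); first by rewrite leq_mul2l lossP orbT.
by rewrite expnS mulnA ltn_pmul2r ?expn_gt0.
Qed.

End Potential.

(** * The limit oracle *)

Lemma ex_advised_oracle (T : nat -> tester) (cost : nat -> seq bool -> nat) :
  (forall e, certificate_bound (T e) (cost e)) ->
  (forall e, exists d, total_cost_bound (T e) (cost e) d) ->
  (forall e, finitely_determined (T e)) ->
  exists (A : language) (d : nat -> nat), forall e n,
    exists2 z, size z = advice_size d e n & advised T A e n z.
Proof.
move=> certP /choice[d costP] finT.
have [a aP] := choice (fun N => advised_below N certP costP).
have [A AP] := language_limit a; exists A, d => e n.
have [B BP] := choice (finT e).
(* All words that matter to [advised] at [e] and [n]: those of every row, as the advice varies with
   the stage, and those determining the answers. *)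
pose S := [seq advice_word e n (tval x) (tval z) | x <- enum {: n.-tuple bool},
      z <- enum {: (advice_size d e n).-tuple bool}] ++
  flatten [seq flatten [seq B u | u <- queries (T e) (tval x) (tval r)] |
           x <- enum {: n.-tuple bool},
           r <- enum {: (coins (T e) n).-tuple bool}].
have [N leN eqA] := AP S (maxn e n).+1.
have [||z sz zP] := aP N e n; [by lia..|exists z => // x].
have -> : [set r : (coins (T e) n).-tuple bool |
              tester_val A (T e) x r == A (advice_word e n x z)] =
          [set r : (coins (T e) n).-tuple bool |
              tester_val (a N) (T e) x r == a N (advice_word e n x z)].
  apply/setP => r; rewrite !inE; congr (_ == _); last first.
    apply/esym/eqA; rewrite mem_cat; apply/orP; left.
    have -> : z = in_tuple z by [].
    by apply/allpairsP; exists (x, tcast sz (in_tuple z));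
       rewrite !mem_enum val_tcast.
  congr verdict; apply/eq_in_map => u qu; apply: BP => w Bw; apply/esym/eqA.
  rewrite mem_cat; apply/orP; right; apply/flattenP.
  exists (flatten [seq B u | u <- queries (T e) x r]); last first.
    by apply/flattenP; exists (B u) => //; apply: map_f.
  by apply/allpairsP; exists (x, r); rewrite !mem_enum.
exact: zP.
Qed.

(** * Runs of oracle machines *)

Fixpoint run_queries (O : language) (M : machine) (t : nat)
    (q : 'I_(nstates M).+1) (ts : (nwork M).+2.-tuple tape) {struct t} :
    seq (seq bool) :=
  if t is t'.+1 then
    match delta q [tuple read_tape (tnth ts i) | i < (nwork M).+2] with
    | Halt _ => [::]
    | Query qy qn =>
        let w := query_word (tnth ts ord_max).1 in
        w :: run_queries O t' (if O w then qy else qn) ts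
    | Move q' acts =>
        run_queries O t' q'
          [tuple update_tape (tnth ts i) (tnth acts i) | i < (nwork M).+2]
    end
  else [::].

(* Queries asked along all the computations, whatever the oracle answers. *)
Fixpoint possible_queries (M : machine) (t : nat)
    (q : 'I_(nstates M).+1) (ts : (nwork M).+2.-tuple tape) {struct t} :
    seq (seq bool) :=
  if t is t'.+1 then
    match delta q [tuple read_tape (tnth ts i) | i < (nwork M).+2] with
    | Halt _ => [::]
    | Query qy qn =>
        query_word (tnth ts ord_max).1 ::
          possible_queries t' qy ts ++ possible_queries t' qn ts
    | Move q' acts =>
        possible_queries t' q'
          [tuple update_tape (tnth ts i) (tnth acts i) | i < (nwork M).+2]
    end
  else [::].

Lemma size_run_queries O M t (q : 'I_(nstates M).+1) ts :
  size (run_queries O t q ts) <= t.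
Proof.
elim: t q ts => //= t IH q ts.
by case: delta => [b|qy qn|q' acts] //=; apply: leq_trans (IH _ _) _.
Qed.

Lemma eq_run O O' M t (q : 'I_(nstates M).+1) ts :
  {in run_queries O t q ts, O =1 O'} -> run O t q ts = run O' t q ts.
Proof.
elim: t q ts => //= t IH q ts.
case: delta => [b|qy qn|q' acts] // eqO; last exact: IH.
rewrite -(eqO _ (mem_head _ _)); apply: IH => w Ow.
by apply: eqO; rewrite inE Ow orbT.
Qed.

Lemma sub_possible_queries O M t (q : 'I_(nstates M).+1) ts :
  {subset run_queries O t q ts <= possible_queries t q ts}.
Proof.
elim: t q ts => //= t IH q ts; case: delta => [b|qy qn|q' acts] //= w.
rewrite !inE mem_cat => /predU1P[->|]; first by rewrite eqxx.
by case: ifP => _ /IH->; rewrite !orbT.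
Qed.

(** Writing extends the tape at most to the cell of the head, and the head moves by at most one, so
    the larger of tape length and head position grows by at most one per step. *)
Lemma run_output_size O M t (q : 'I_(nstates M).+1) ts b o h :
  maxn (size (tnth ts ord_max).1) (tnth ts ord_max).2 <= h ->
  run O t q ts = Some (b, o) -> size o <= h + t.
Proof.
elim: t q ts h => //= t IH q ts h le_h.
move: (le_h); rewrite geq_max => /andP[le_s le_pos].
case: delta => [b'|qy qn|q' acts].
  by case=> _ <-; apply: leq_trans le_s (leq_addr _ _).
  by move=> /(IH _ _ h); rewrite addnS => /(_ le_h) /leqW.
move=> /(IH _ _ h.+1); rewrite addSnnS; apply.
rewrite tnth_mktuple; case: (tnth acts _) => a d /=.
rewrite size_set_nth !geq_max ltnS le_pos (leqW le_s) /=.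
by case: d => //=; [apply: leq_trans (leq_pred _) _|]; apply: leqW.
Qed.

Lemma output_size O M p z : size (output O M p z) <= polyval p (size z).
Proof.
rewrite /output; case run_z: exec => [[b o]|//].
by apply: (run_output_size (h := 0) _ run_z); rewrite tnth_mktuple.
Qed.

Definition exec_queries (O : language) (M : machine) (t : nat) (z : seq symbol) :=
  @run_queries O M t ord0 (init_tapes (nwork M) z).

Lemma eq_accepts O O' M p z :
  {in exec_queries O M (polyval p (size z)) z, O =1 O'} ->
  accepts O M p z = accepts O' M p z.
Proof. by move=> /eq_run eqO; rewrite /accepts /exec eqO. Qed.

Lemma accepts_finitely_determined M p z :
  exists S : seq (seq bool), forall O O' : language,
    {in S, O =1 O'} -> accepts O M p z = accepts O' M p z.
Proof.
exists (@possible_queries M (polyval p (size z)) ord0 (init_tapes (nwork M) z)).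
by move=> O O' eqO; apply: eq_accepts => w /sub_possible_queries/eqO.
Qed.

Lemma size_decode_from w s : size (decode_from w s) <= size s.
Proof.
by elim: s w => //= -[||b] s IH w //=; rewrite ?ltnS ?IH // ltnW // ltnS.
Qed.

Lemma size_mem_decode_from w s u :
  u \in decode_from w s -> size u <= size w + size s.
Proof.
elim: s w => //= -[||b] s IH w //=.
  rewrite inE => /predU1P[->|]; first exact: leq_addr.
  by move=> /IH /= le_u; lia.
by move=> /IH; rewrite size_rcons addSnnS.
Qed.

Lemma size_encode ws : size (encode ws) = \sum_(w <- ws) (size w).+1.
Proof.
elim: ws => [|w ws IH]; first by rewrite big_nil.
by rewrite big_cons /encode /= size_cat size_rcons size_map -/(encode ws) IH.
Qed.

(** * Polynomial bounds *)

Lemma leq_expl m n e : m <= n -> m ^ e <= n ^ e.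
Proof. by case: e => // e; rewrite leq_exp2r. Qed.

(** With a base of at least 2, constants are absorbed by the exponent. *)
Definition poly_bounded (f : nat -> nat) : Prop :=
  exists k, forall n, f n <= n.+2 ^ k.

Lemma poly_boundedD f g :
  poly_bounded f -> poly_bounded g -> poly_bounded (fun n => f n + g n).
Proof.
move=> [i fi] [j gj]; exists (i + j).+1 => n; rewrite expnS.
apply: (@leq_trans (n.+2 ^ (i + j) + n.+2 ^ (i + j))); last first.
  by rewrite mulSnr mulSn; lia.
by apply: leq_add; [apply: leq_trans (fi n) _ | apply: leq_trans (gj n) _];
   rewrite leq_exp2l //; lia.
Qed.

Lemma poly_boundedM f g :
  poly_bounded f -> poly_bounded g -> poly_bounded (fun n => f n * g n).
Proof.
by move=> [i fi] [j gj]; exists (i + j) => n; rewrite expnD leq_mul.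
Qed.

Lemma poly_bounded_cst c : poly_bounded (fun=> c).
Proof.
exists c => n; apply: leq_trans (ltnW (ltn_expl c (ltnSn 1))) _.
exact: leq_expl.
Qed.

Lemma poly_bounded_id : poly_bounded id.
Proof. by exists 1 => n; rewrite expn1; lia. Qed.

Lemma poly_bounded_polyval p f : poly_bounded f ->
  exists2 g, poly_bounded g & forall n m, m <= f n -> polyval p m <= g n.
Proof.
move=> pf; rewrite /polyval.
elim/poly_ind: p => [|p c [g pg gP]].
  by exists (fun=> 0) => [|n m _]; [exact: poly_bounded_cst | rewrite horner0].
exists (fun n => g n * f n + c) => [|n m le_m].
  by apply: poly_boundedD (poly_bounded_cst c); apply: poly_boundedM.
by rewrite hornerMXaddC; apply/(leq_add _ (leqnn c))/(leq_mul _ le_m)/gP.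
Qed.

Lemma poly_bounded_exp2 f :
  poly_bounded f -> exists d, forall n, f n <= 2 ^ (n + d).
Proof.
case=> k fk; suff [d dP] : exists d, forall n, n.+2 ^ k <= 2 ^ (n + d).
  by exists d => n; apply: leq_trans (fk n) _.
(* [n + 2 <= 2k * 2^(n / k + 1)], raised to the power [k] *)
exists (k.*2 ^ k + k) => n.
have [->|k_gt0] := posnP k; first by rewrite expn0 expn_gt0.
apply: (@leq_trans ((k.*2 * 2 ^ (n %/ k).+1) ^ k)).
  apply: leq_expl; have := ltn_ceil n k_gt0.
  have := ltn_expl (n %/ k).+1 (ltnSn 1).
  by move: (2 ^ _) => e le_e lt_n; nia.
rewrite expnMn -expnM addnCA expnD leq_mul //; first exact/ltnW/ltn_expl.
by rewrite leq_exp2l // mulSn addnC leq_add2r leq_trunc_div.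
Qed.

(** * Enumeration of the machines *)

Definition symbol_code (a : symbol) : option (option bool) :=
  match a with Blank => None | Sep => Some None | Bit b => Some (Some b) end.

Definition symbol_decode (c : option (option bool)) : symbol :=
  match c with None => Blank | Some None => Sep | Some (Some b) => Bit b end.

Lemma symbol_codeK : cancel symbol_code symbol_decode.
Proof. by case. Qed.

HB.instance Definition _ := Countable.copy symbol (can_type symbol_codeK).
HB.instance Definition _ : isFinite symbol := CanIsFinite symbol_codeK.

Definition direction_code (a : direction) : option bool :=
  match a with Left => Some false | Stay => None | Right => Some true end.

Definition direction_decode (c : option bool) : direction :=
  match c with Some false => Left | None => Stay | Some true => Right end.

Lemma direction_codeK : cancel direction_code direction_decode.
Proof. by case. Qed.

HB.instance Definition _ := Countable.copy direction (can_type direction_codeK).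

Section InstructionCode.

Variables s k : nat.

Definition instruction_code (a : instruction s k) :
    bool + 'I_s * 'I_s + 'I_s * k.-tuple (symbol * direction) :=
  match a with
  | Halt b => inl (inl b)
  | Query qy qn => inl (inr (qy, qn))
  | Move q acts => inr (q, acts)
  end.

Definition instruction_decode
    (c : bool + 'I_s * 'I_s + 'I_s * k.-tuple (symbol * direction)) :
    instruction s k :=
  match c with
  | inl (inl b) => Halt b
  | inl (inr (qy, qn)) => Query qy qn
  | inr (q, acts) => Move q acts
  end.

Lemma instruction_codeK : cancel instruction_code instruction_decode.
Proof. by case. Qed.

HB.instance Definition _ :=
  Countable.copy (instruction s k) (can_type instruction_codeK).

End InstructionCode.

Definition program (s k : nat) : Type :=
  {ffun 'I_s.+1 * k.+2.-tuple symbol -> instruction s.+1 k.+2}.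

HB.instance Definition _ s k := Countable.on (program s k).

Definition machine_code (M : machine) : {s : nat & {k : nat & program s k}} :=
  existT _ (nstates M) (existT _ (nwork M) [ffun a => delta a.1 a.2]).

Definition machine_decode (c : {s : nat & {k : nat & program s k}}) : machine :=
  let: existT s (existT k f) := c in @Machine s k (fun q a => f (q, a)).

Lemma machine_codeK : cancel machine_code machine_decode.
Proof.
case=> s k f; rewrite /machine_code /machine_decode /=; congr Machine.
by apply: funext => q; apply: funext => a; rewrite ffunE.
Qed.

HB.instance Definition _ := Countable.copy machine (can_type machine_codeK).

(** * Testers of nonadaptive machines *)

(** A countable type, so that one oracle can serve all these machines by index. *)
Record description := Description {
  verifier : machine; verifier_time : {poly nat}; witness_size : {poly nat};
  generator : machine; generator_time : {poly nat};
  decider : machine; decider_time : {poly nat};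
  coin_number : {poly nat}
}.

Definition description_code (c : description) :=
  let: Description V p q G pG D pD m := c in
  (V, G, D, [:: polyseq p; polyseq q; polyseq pG; polyseq pD; polyseq m]).

Definition description_decode
    (c : machine * machine * machine * seq (seq nat)) : description :=
  let: (V, G, D, ps) := c in
  let poly i := Poly (nth [::] ps i) in
  Description V (poly 0) (poly 1) G (poly 2) D (poly 3) (poly 4).

Lemma description_codeK : cancel description_code description_decode.
Proof.
by case=> V p q G pG D pD m; rewrite /description_decode /= !polyseqK.
Qed.

HB.instance Definition _ :=
  Countable.copy description (can_type description_codeK).

Definition has_witness (c : description) (A : language) (u : seq bool) : bool :=
  [exists j : 'I_(polyval (witness_size c) (size u)).+1,
     [exists w : j.-tuple bool,
        accepts A (verifier c) (verifier_time c) (encode [:: u; tval w])]].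

Lemma has_witnessP c A u :
  reflect (exists2 w : seq bool, size w <= polyval (witness_size c) (size u) &
             accepts A (verifier c) (verifier_time c) (encode [:: u; w]))
          (has_witness c A u).
Proof.
apply: (iffP existsP) => [[j /existsP[w acc]]|[w le_w acc]].
  by exists w; rewrite // size_tuple -ltnS.
by exists (Ordinal (le_w : size w < _.+1)); apply/existsP; exists (in_tuple w).
Qed.

Definition described_tester (c : description) : tester := {|
  coins n := polyval (coin_number c) n;
  queries x r :=
    decode (output no_oracle (generator c) (generator_time c) (encode [:: x; r]));
  answer A u := has_witness c A u;
  verdict x r answers :=
    accepts no_oracle (decider c) (decider_time c) (encode [:: x; r; answers])
|}.

Definition described_cost (c : description) (u : seq bool) : nat :=
  \max_(j < (polyval (witness_size c) (size u)).+1)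
    polyval (verifier_time c) (size u + j + 2).

(** The certificate consists of the words asked in an accepting run: an oracle that agrees on them
    gives the same run. *)
Lemma described_certificate_bound c :
  certificate_bound (described_tester c) (described_cost c).
Proof.
move=> A u /has_witnessP[w le_w acc].
pose time := polyval (verifier_time c) (size (encode [:: u; w])).
exists (exec_queries A (verifier c) time (encode [:: u; w])).
  apply: leq_trans (size_run_queries _ _ _ _) _; rewrite /time size_encode.
  rewrite big_cons big_seq1 (_ : _ + _ = size u + size w + 2); last by lia.
  exact: (leq_bigmax (Ordinal (le_w : size w < _.+1))).
by move=> A' eqA; apply/has_witnessP; exists w; rewrite // -(eq_accepts eqA).
Qed.

Lemma described_finitely_determined c :
  finitely_determined (described_tester c).
Proof.
move=> u; have [S SP] := choice (fun w => accepts_finitely_determined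
  (verifier c) (verifier_time c) (encode [:: u; w])).
exists (flatten [seq flatten [seq S (tval w) | w <- enum {: j.-tuple bool}]
                | j <- iota 0 (polyval (witness_size c) (size u)).+1]).
move=> A A' eqA; apply: eq_existsb => j; apply: eq_existsb => w.
apply: SP => v Sv; apply: eqA; apply/flattenP.
exists (flatten [seq S (tval w') | w' <- enum {: j.-tuple bool}]).
  by apply/mapP; exists (j : nat); rewrite ?mem_iota ?add0n ?ltn_ord.
by apply/flattenP; exists (S w) => //; apply/mapP; exists w; rewrite ?mem_enum.
Qed.

(** The size of the generator's output bounds both the number and the lengths of the queries, so the
    total cost is polynomial in [n]. *)
Lemma described_total_cost_bound c :
  exists d, total_cost_bound (described_tester c) (described_cost c) d.
Proof.
have [l pl lP] := poly_bounded_polyval (coin_number c) poly_bounded_id.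
have [o po oP] := poly_bounded_polyval (generator_time c)
  (poly_boundedD (poly_boundedD poly_bounded_id pl) (poly_bounded_cst 2)).
have [q pq qP] := poly_bounded_polyval (witness_size c) po.
have [t pt tP] := poly_bounded_polyval (verifier_time c)
  (poly_boundedD (poly_boundedD po pq) (poly_bounded_cst 2)).
have [d dP] := poly_bounded_exp2 (poly_boundedM po pt).
exists d => n x r sx /= sr; apply: leq_trans (dP n).
set tp := output _ _ _ _.
have le_tp : size tp <= o n.
  apply: leq_trans (output_size _ _ _ _) _; apply: oP.
  by rewrite size_encode big_cons big_seq1 sx sr; have := lP n n (leqnn n); lia.
apply: (@leq_trans (\sum_(u <- decode tp) t n)).
  rewrite !big_seq; apply: leq_sum => u /size_mem_decode_from /= le_u.
  have {}le_u : size u <= o n by apply: leq_trans le_tp.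
  apply/bigmax_leqP => j _; apply: tP.
  apply: leq_add (leqnn 2); apply: (leq_add le_u); apply: leq_trans (qP n _ le_u).
  by rewrite -ltnS.
rewrite big_const_seq count_predT iter_addn_0 mulnC leq_mul2r.
by rewrite (leq_trans (size_decode_from _ _)) ?orbT.
Qed.

(** * Linear-size circuits *)

Definition advice_wires (e n : nat) (z : seq bool) : seq (wire n) :=
  nseq e (Const true) ++ Const false :: nseq n (Const true) ++
    Const false :: [seq Input i | i <- enum 'I_n] ++ [seq Const b | b <- z].

Lemma advice_wires_before e n z i : all (@wire_before n i) (advice_wires e n z).
Proof.
rewrite !(all_cat, all_nseq) /= !(all_cat, all_nseq) /= !orbT all_cat !all_map /=.
by apply/andP; split; apply/allP.
Qed.

Lemma size_advice_wires e n z :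
  size (advice_wires e n z) = e + n + n + size z + 2.
Proof.
have := size_enum_ord n; rewrite /advice_wires; move: (enum _) => xs size_xs.
rewrite !(size_cat, size_nseq) /= !(size_cat, size_nseq) /= size_cat !size_map.
by rewrite size_xs; lia.
Qed.

Lemma val_advice_wires e n z (x : n.-tuple bool) vals :
  [seq wire_val x vals u | u <- advice_wires e n z] = advice_word e n x z.
Proof.
have := map_tnth_enum x; rewrite /advice_wires; move: (enum _) => xs xsP.
rewrite map_cat map_nseq /= map_cat map_nseq /= map_cat -!map_comp.
by rewrite [map _ xs]xsP [map _ z]map_id.
Qed.

Lemma advice_circuit_wf e n z :
  gates_wf 0 [:: OracleGate (advice_wires e n z)] &&
  @wire_before n (size [:: OracleGate (advice_wires e n z)]) (FromGate 0).
Proof. by rewrite /= advice_wires_before. Qed.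

Definition advice_circuit e n z : circuit n := Circuit (advice_circuit_wf e n z).

Lemma advice_circuit_eval A e n z (x : n.-tuple bool) :
  circuit_eval A (advice_circuit e n z) x = A (advice_word e n x z).
Proof. by rewrite /circuit_eval /= val_advice_wires. Qed.

Lemma advice_circuit_size e n z :
  circuit_size (advice_circuit e n z) = e + n + n + size z + 3.
Proof. by rewrite /circuit_size big_seq1 /= size_advice_wires; lia. Qed.

Lemma advised_linear_size (A L : language) (e k : nat) :
  (forall n, exists2 z, size z = 8 * (n + k) &
     forall x : n.-tuple bool, A (advice_word e n x z) = L x) ->
  has_linear_size_circuits A L.
Proof.
(* For positive [n] the oracle gate has size [10 * n + e + 8 * k + 3], at most this multiple of
   [n]. *)
move=> advL; exists (e + 8 * k + 13).
suff /all_tag[C CP] : forall n, {C : circuit n |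
    circuit_size C <= (e + 8 * k + 13) * n /\
    forall x : n.-tuple bool, circuit_eval A C x = L x} by exists C.
case=> [|n]; apply: cid.
  (* Length 0 requires size 0, hence a circuit without gates. *)
  exists (@Circuit 0 [::] (Const (L [::])) isT).
  by split=> [|x]; [rewrite /circuit_size big_nil | rewrite tuple0].
have [z sz zP] := advL n.+1; exists (advice_circuit e n.+1 z).
by split=> [|x]; rewrite ?advice_circuit_size ?advice_circuit_eval ?sz //; nia.
Qed.

(** Were the row wrong at [x], all coins agreeing with it would err, and they are more than a
    third. *)
Lemma advised_bounded_error (T : nat -> tester) (A L : language) (e n : nat)
    (z : seq bool) :
  advised T A e n z ->
  (forall x : n.-tuple bool,
    3 * #|[set r : (coins (T e) n).-tuple bool |
             tester_val A (T e) x r != L x]| <= 2 ^ coins (T e) n) ->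
  forall x : n.-tuple bool, A (advice_word e n x z) = L x.
Proof.
move=> adv err x; apply/eqP/negPn/negP => neq.
have := leq_ltn_trans (err x) (adv x); rewrite ltn_mul2l /= ltnNge => /negP[].
apply/subset_leq_card/subsetP => r; rewrite !inE.
by move=> /eqP->.
Qed.

Theorem theorem8 :
  exists A : language, forall L : language,
    in_BPP_par_NP A L -> has_linear_size_circuits A L.
Proof.
pose idle := @Machine 0 0 (fun _ _ => Halt false).
(* Every description occurs at its code; numbers coding none get an idle machine. *)
pose c e := odflt (Description idle 0 0 idle 0 idle 0 0) (unpickle e).
have [A [d AP]] := ex_advised_oracle
  (fun e => @described_certificate_bound (c e))
  (fun e => described_total_cost_bound (c e))
  (fun e => @described_finitely_determined (c e)).
exists A => L [K [[V [p [q [_ KP]]]] [G [D [pG [pD [m [_ _ LP]]]]]]]].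
pose descr := Description V p q G pG D pD m.
have c_pickle : c (pickle descr) = descr by rewrite /c pickleK.
have eqK : has_witness descr A =1 K by move=> u; apply/has_witnessP/idP => /KP.
apply: (@advised_linear_size A L (pickle descr)
                             (pickle descr + d (pickle descr) + 1)).
move=> n; have [z sz zP] := AP (pickle descr) n; exists z => //.
apply: advised_bounded_error zP _ => x; rewrite c_pickle.
have := LP x; rewrite size_tuple; apply: leq_trans; rewrite leq_mul2l /=.
apply/subset_leq_card/subsetP => r; rewrite !inE /tester_val /=.
by rewrite (eq_map eqK).
Qed.
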